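(* All étale groupoids with locally compact Hausdorff unit spaces and all proper couple morphisms between them form a subcategory of the category $\mathbf{EG}$ of étale groupoids and equivalence classes of couple morphisms.
   Context: A groupoid $G$ has unit space $G^{(0)}\subset G$, domain and range maps $d,r\colon G\to G^{(0)}$; $g'g$ is defined iff $d(g')=r(g)$. $G_u:=d^{-1}(u)$ for $u\in G^{(0)}$. A topological groupoid has a topology making multiplication and inversion continuous ($G^{(0)}$ has the subspace topology); it is étale if $d\colon G\to G^{(0)}$ is a local homeomorphism. The arrow space is not assumed Hausdorff. For a groupoid homomorphism $\varphi\colon G\to H$ let $\varphi^{(0)}\colon G^{(0)}\to H^{(0)}$ and $\varphi_u\colon G_u\to H_{\varphi(u)}$ be its restrictions. $\varphi$ is fibrewise bijective if $\varphi_u$ is bijective for all $u\in G^{(0)}$. For étale groupoids $G,H$, a couple morphism $(\varphi,\psi;K)\colon G\to H$ consists of an étale groupoid $K$, a continuous fibrewise bijective groupoid homomorphism $\varphi\colon K\to G$, and a continuous groupoid homomorphism $\psi\colon K\to H$ with $\psi^{(0)}$ open and injective. Couple morphisms $(\varphi_i,\psi_i;K_i)$, $i=1,2$, from $G$ to $H$ are equivalent if there is a homeomorphic groupoid isomorphism $\iota\colon K_1\to K_2$ with $\varphi_2\circ\iota=\varphi_1$, $\psi_2\circ\iota=\psi_1$. $[\varphi,\psi;K]$ denotes the equivalence class, also called a couple morphism. It is proper if $\varphi^{(0)}\colon K^{(0)}\to G^{(0)}$ is proper (preimages of compact sets are compact); this does not depend on the representative. $\mathbf{EG}$: objects are étale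 groupoids, morphisms are equivalence classes of couple morphisms, the identity of $G$ is $[\mathrm{id}_G,\mathrm{id}_G;G]$, and the composition of $[\varphi_1,\psi_1;K_1]\colon G_1\to G_2$ and $[\varphi_2,\psi_2;K_2]\colon G_2\to G_3$ is $[\varphi_1\circ\widetilde{\varphi_2},\psi_2\circ\widetilde{\psi_1};K_1\times_{G_2}K_2]$, where $K_1\times_{G_2}K_2:=\{(k_1,k_2)\in K_1\times K_2:\psi_1(k_1)=\varphi_2(k_2)\}$ with component-wise structure and topology induced from the product, $\widetilde{\varphi_2}(k_1,k_2):=k_1$, $\widetilde{\psi_1}(k_1,k_2):=k_2$. *)

(* Defs.v *)
From HB Require Import structures.
From mathcomp Require Import all_boot all_classical topology.

Set Implicit Arguments.
Unset Strict Implicit.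
Unset Printing Implicit Defensive.

Local Open Scope classical_set_scope.

Definition homeomorphism_on (X Y : topologicalType) (A : set X) (B : set Y)
    (f : X -> Y) :=
  exists g : Y -> X,
    [/\ f @` A = B, g @` B = A, {in A, cancel f g},
        {within A, continuous f} & {within B, continuous g}].

Definition local_homeomorphism (X Y : topologicalType) (f : X -> Y) :=
  forall x : X, exists U : set X,
    [/\ open U, U x, open (f @` U) & homeomorphism_on U (f @` U) f].

Definition open_map (X Y : topologicalType) (f : X -> Y) :=
  forall U : set X, open U -> open (f @` U).

Definition proper_map (X Y : topologicalType) (f : X -> Y) :=
  forall C : set Y, compact C -> compact (f @^-1` C).

Lemma nbhs_set_type (X : topologicalType) (A : set X) (x : A) (U : set A) :
  nbhs x U <-> exists W : set X, [/\ open W, W (val x) &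
    forall y : A, W (val y) -> U y].
Proof.
split=> [|[W [oW Wx WU]]].
  by move=> [_ [[W oW <-] /= Wx WU]]; exists W; split=> // y Wy; apply: WU.
exists (set_val @^-1` W); split=> //; first by exists W.
Qed.

Lemma continuous_set_val (X : topologicalType) (A : set X) :
  continuous (fun x : A => val x).
Proof. by move=> x; exact: initial_continuous. Qed.

Lemma continuous_to_set_type (X Y : topologicalType) (A : set Y) (f : X -> A) :
  continuous (fun x => val (f x)) -> continuous f.
Proof.
move=> cf x U /nbhs_set_type[W [oW Wx WU]].
have nW : nbhs x [set y | W (val (f y))].
  exact: (cf x W (open_nbhs_nbhs (conj oW Wx))).
rewrite nbhs_simpl/=; apply: filterS nW => y; exact: WU.
Qed.

Lemma continuous_pair (X Y Z : topologicalType) (f : X -> Y) (g : X -> Z) :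
  continuous f -> continuous g -> continuous (fun x => (f x, g x)).
Proof. by move=> cf cg x; exact: (cvg_pair (cf x) (cg x)). Qed.

Lemma continuous_fst (X Y : topologicalType) :
  continuous (fun p : X * Y => p.1).
Proof. by move=> p; exact: cvg_fst. Qed.

Lemma continuous_snd (X Y : topologicalType) :
  continuous (fun p : X * Y => p.2).
Proof. by move=> p; exact: cvg_snd. Qed.

Lemma continuous_cmp (X Y Z : topologicalType) (f : X -> Y) (g : Y -> Z) :
  continuous f -> continuous g -> continuous (fun x => g (f x)).
Proof. by move=> cf cg x; apply: continuous_comp; [exact: cf|exact: cg]. Qed.

Lemma open_mapP (X Y : topologicalType) (f : X -> Y) :
  open_map f <-> forall x V, nbhs x V -> nbhs (f x) (f @` V).
Proof.
split=> [fo x V|fo U oU].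
  rewrite nbhsE => -[W [oW Wx] WV].
  apply: (@filterS _ _ _ (f @` W)); first exact: image_subset.
  by apply: open_nbhs_nbhs; split; [exact: fo|exists x].
by rewrite openE => _ [x Ux <-]; apply: fo; exact: open_nbhs_nbhs.
Qed.

Lemma within_continuousP (X Y : topologicalType) (A : set X) (f : X -> Y) :
  {within A, continuous f} <->
  forall x V, A x -> nbhs (f x) V -> nbhs x [set y | A y -> V (f y)].
Proof.
rewrite subspace_continuousP; split=> [cf x V Ax nV|cf x Ax V nV].
  exact: cf nV.
exact: (cf x V Ax nV).
Qed.

Lemma local_homeomorphismP (X Y : topologicalType) (f : X -> Y) :
  local_homeomorphism f <->
  [/\ continuous f, open_map f &
      forall x, exists U, [/\ open U, U x & {in U &, injective f}]].
Proof.
split=> [lf|[cf fo fi] x].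
  split=> [x|| x].
  - have [U [oU Ux _ [g [_ _ _ /within_continuousP cf _]]]] := lf x.
    move=> V nV; rewrite nbhs_simpl/=.
    have nU : nbhs x U by exact: open_nbhs_nbhs.
    by move: (cf x V Ux nV) nU; apply: filterS2 => y; apply.
  - apply/open_mapP => x V nV.
    have [U [oU Ux ofU [g [_ _ gK _ /within_continuousP cg]]]] := lf x.
    have fUfx : (f @` U) (f x) by exists x.
    have := cg (f x) V fUfx; rewrite gK ?inE// => /(_ nV) nW.
    have nU : nbhs (f x) (f @` U) by exact: open_nbhs_nbhs.
    move: nW nU; apply: filterS2 => y Vgy [z Uz zy].
    exists z => //; move: Vgy; rewrite -zy => /(_ (imageP f Uz)).
    by rewrite gK ?inE.
  - have [U [oU Ux _ [g [_ _ gK _ _]]]] := lf x.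
    exists U; split=> // y z yU zU yz.
    by rewrite -(gK y yU) -(gK z zU) yz.
have [U [oU Ux finj]] := fi x.
exists U; split=> //; first exact: fo.
have gex y : exists z, (f @` U) y -> U z /\ f z = y.
  have [[z Uz <-]|nU] := pselect ((f @` U) y); first by exists z.
  by exists x.
have [g gP] := choice gex.
have gK : {in U, cancel f g}.
  move=> y /set_mem Uy; have [|Ug fg] := gP (f y); first by exists y.
  by apply: finj; rewrite ?inE.
exists g; split=> //.
- apply/seteqP; split=> [_ [_ [y Uy <-] <-]|y Uy]; first by rewrite gK ?inE.
  by exists (f y); [exists y|rewrite gK ?inE].
- exact: continuous_subspaceT.
- apply/within_continuousP => y V fUy; have [Ugy fgy] := gP y fUy => nV.
  have : nbhs (f (g y)) (f @` (V `&` U)).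
    move/open_mapP: fo; apply; apply: filterI => //.
    exact: open_nbhs_nbhs.
  by rewrite fgy; apply: filterS => _ [t [Vt Ut] <-] _; rewrite gK ?inE.
Qed.

(* The arrow set carries a topology, but its compatibility with the operations
   is only required in [is_topological_groupoid]. [unit_space], read as a type,
   has the subspace topology. *)
Record groupoid := Groupoid {
  arrow :> topologicalType;
  unit_space : set arrow;
  dom : arrow -> unit_space;
  rng : arrow -> unit_space;
  mul : forall g' g : arrow, dom g' = rng g -> arrow;
  inv : arrow -> arrow;
  dom_unit : forall u : unit_space, dom (val u) = u;
  rng_unit : forall u : unit_space, rng (val u) = u;
  dom_mul : forall g' g (e : dom g' = rng g), dom (mul e) = dom g;
  rng_mul : forall g' g (e : dom g' = rng g), rng (mul e) = rng g';
  mul_unitr : forall g (e : dom g = rng (val (dom g))), mul e = g;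
  mul_unitl : forall g (e : dom (val (rng g)) = rng g), mul e = g;
  mulA : forall g3 g2 g1 (e32 : dom g3 = rng g2) (e21 : dom g2 = rng g1)
    (el : dom (mul e32) = rng g1) (er : dom g3 = rng (mul e21)),
    mul el = mul er;
  dom_inv : forall g, dom (inv g) = rng g;
  rng_inv : forall g, rng (inv g) = dom g;
  mul_invl : forall g (e : dom (inv g) = rng g), mul e = val (dom g);
  mul_invr : forall g (e : dom g = rng (inv g)), mul e = val (rng g) }.

Arguments unit_space : clear implicits.
Arguments dom {_} _.
Arguments rng {_} _.
Arguments mul {_ _ _} _.
Arguments inv {_} _.

Definition composable (G : groupoid) : set (G * G) :=
  [set p | dom p.1 = rng p.2].
Arguments composable : clear implicits.

Definition mul_pair (G : groupoid) (p : composable G) : G := mul (set_valP p).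

Record is_topological_groupoid (G : groupoid) : Prop := {
  continuous_mul : continuous (@mul_pair G);
  continuous_inv : continuous (@inv G) }.

Record is_etale (G : groupoid) : Prop := {
  etale_topological :> is_topological_groupoid G;
  etale_dom : local_homeomorphism (@dom G) }.

Record etale_groupoid := EtaleGroupoid {
  etale_carrier :> groupoid;
  etaleP : is_etale etale_carrier }.

Lemma mul_eq (G : groupoid) (g' g h' h : G) (e : dom g' = rng g)
  (e' : dom h' = rng h) : g' = h' -> g = h -> mul e = mul e'.
Proof. by move=> gh' gh; subst; congr mul; exact: Prop_irrelevance. Qed.

Definition source_fibre (G : groupoid) (u : unit_space G) : set G :=
  [set g | dom g = u].

Record groupoid_hom (G H : groupoid) := GroupoidHom {
  hom_fun :> G -> H;
  hom_dom : forall g, val (dom (hom_fun g)) = hom_fun (val (dom g));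
  hom_rng : forall g, val (rng (hom_fun g)) = hom_fun (val (rng g));
  hom_mul : forall g' g (e : dom g' = rng g)
    (e' : dom (hom_fun g') = rng (hom_fun g)),
    hom_fun (mul e) = mul e' }.

Section Restrictions.
Variables (G H : groupoid) (f : groupoid_hom G H).

Lemma hom_unit (u : unit_space G) : unit_space H (f (val u)).
Proof. by rewrite -[u in f (val u)]dom_unit -hom_dom; exact: set_valP. Qed.

Definition hom0 (u : unit_space G) : unit_space H := SigSub (mem_set (hom_unit u)).

Lemma val_hom0 u : val (hom0 u) = f (val u). Proof. by []. Qed.

Lemma dom_hom g : dom (f g) = hom0 (dom g).
Proof. by apply: val_inj; rewrite hom_dom. Qed.

Lemma rng_hom g : rng (f g) = hom0 (rng g).
Proof. by apply: val_inj; rewrite hom_rng. Qed.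

Lemma hom_composable g' g : dom g' = rng g -> dom (f g') = rng (f g).
Proof. by rewrite dom_hom rng_hom => ->. Qed.

Lemma hom_inv g : f (inv g) = inv (f g).
Proof.
have e1 : dom (f (inv g)) = rng (f g) by apply: hom_composable; rewrite dom_inv.
have e2 : dom (f g) = rng (inv (f g)) by rewrite rng_inv.
have e3 : dom (mul e1) = rng (inv (f g)) by rewrite dom_mul.
have e4 : dom (f (inv g)) = rng (mul e2) by rewrite rng_mul.
have := mulA e3 e4.
have -> : mul e3 = inv (f g).
  have e5 : dom (val (rng (inv (f g)))) = rng (inv (f g)) by rewrite dom_unit.
  rewrite -[RHS](mul_unitl e5); apply: mul_eq => //.
  rewrite -(hom_mul (dom_inv g)) mul_invl rng_inv.
  by rewrite dom_hom.
have -> : mul e4 = f (inv g) => [|-> //].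
have e5 : dom (f (inv g)) = rng (val (dom (f (inv g)))) by rewrite rng_unit.
rewrite -[RHS](mul_unitr e5); apply: mul_eq => //.
by rewrite mul_invr dom_hom rng_hom dom_inv.
Qed.

Definition fibrewise_bijective := forall u : unit_space G,
  set_bij (source_fibre u) (source_fibre (hom0 u)) f.

End Restrictions.

Lemma continuous_dom (G : etale_groupoid) : continuous (@dom G).
Proof. by have /local_homeomorphismP[] := etale_dom (etaleP G). Qed.

Lemma continuous_rng (G : etale_groupoid) : continuous (@rng G).
Proof.
have -> : @rng G = fun g => dom (inv g) by apply/funext => g; rewrite dom_inv.
apply: continuous_cmp (@continuous_dom G).
exact: continuous_inv (etaleP G).
Qed.

Lemma continuous_mul_pair (X : topologicalType) (H : groupoid) (g' g : X -> H)
  (e : forall x, dom (g' x) = rng (g x)) : is_topological_groupoid H ->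
  continuous g' -> continuous g -> continuous (fun x => mul (e x)).
Proof.
move=> tH cg' cg.
pose h x : composable H := SigSub (mem_set (e x : composable H (g' x, g x))).
rewrite (_ : (fun x => _) = fun x => mul_pair (h x)); last first.
  by apply/funext => x; exact: mul_eq.
apply: continuous_cmp (continuous_mul tH).
by apply: continuous_to_set_type; exact: continuous_pair.
Qed.

Lemma continuous_hom0 (G H : groupoid) (f : groupoid_hom G H) :
  continuous f -> continuous (hom0 f).
Proof.
move=> cf; apply: continuous_to_set_type.
exact: continuous_cmp (@continuous_set_val _ _) cf.
Qed.

Definition id_hom (G : groupoid) : groupoid_hom G G.
Proof.
by refine (@GroupoidHom G G id _ _ _) => // g' g e e'; exact: mul_eq.
Defined.

Definition comp_hom (G H K : groupoid) (f : groupoid_hom G H)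
  (g : groupoid_hom H K) : groupoid_hom G K.
Proof.
refine (@GroupoidHom G K (fun x => g (f x)) _ _ _) => [x|x|x' x e e'].
- by rewrite !hom_dom.
- by rewrite !hom_rng.
- by rewrite (hom_mul e (hom_composable f e)) hom_mul.
Defined.

(* [mid], [left] and [right] are the K, phi and psi of the couple morphism
   (phi, psi; K). *)
Record couple (G H : etale_groupoid) := Couple {
  mid : etale_groupoid;
  left : groupoid_hom mid G;
  right : groupoid_hom mid H;
  left_continuous : continuous left;
  left_bijective : fibrewise_bijective left;
  right_continuous : continuous right;
  right_open : open_map (hom0 right);
  right_inj : injective (hom0 right) }.

Definition couple_equiv (G H : etale_groupoid) (c1 c2 : couple G H) : Prop :=
  exists (i : groupoid_hom (mid c1) (mid c2))
         (j : groupoid_hom (mid c2) (mid c1)),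
    [/\ cancel i j /\ cancel j i, continuous i /\ continuous j,
        left c2 \o i = left c1 & right c2 \o i = right c1].

Section FibreProduct.
Variables (K1 K2 G : groupoid).
Variables (f1 : groupoid_hom K1 G) (f2 : groupoid_hom K2 G).

Definition fibre_product : set (K1 * K2) := [set k | f1 k.1 = f2 k.2].

Definition fp_pair k1 k2 (e : f1 k1 = f2 k2) : fibre_product :=
  SigSub (mem_set (e : fibre_product (k1, k2))).

Definition fp_unit_space : set fibre_product :=
  [set k | unit_space K1 (val k).1 /\ unit_space K2 (val k).2].

Lemma fp_eq (k l : fibre_product) :
  (val k).1 = (val l).1 -> (val k).2 = (val l).2 -> k = l.
Proof.
move=> e1 e2; apply: val_inj; rewrite [LHS]surjective_pairing e1 e2.
by rewrite -surjective_pairing.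
Qed.

Lemma fp_unit_eq (u v : fp_unit_space) :
  (val (val u)).1 = (val (val v)).1 -> (val (val u)).2 = (val (val v)).2 ->
  u = v.
Proof. by move=> e1 e2; apply: val_inj; exact: fp_eq. Qed.

Lemma fpP (k : fibre_product) : f1 (val k).1 = f2 (val k).2.
Proof. exact: (set_valP k). Qed.

Lemma fp_unitP (u1 : unit_space K1) (u2 : unit_space K2)
  (e : f1 (val u1) = f2 (val u2)) : fp_unit_space (fp_pair e).
Proof. by split; exact: set_valP. Qed.

Definition fp_unit u1 u2 (e : f1 (val u1) = f2 (val u2)) : fp_unit_space :=
  SigSub (mem_set (fp_unitP e)).

Definition fp_unit1 (u : fp_unit_space) : unit_space K1 :=
  SigSub (mem_set (proj1 (set_valP u))).

Definition fp_unit2 (u : fp_unit_space) : unit_space K2 :=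
  SigSub (mem_set (proj2 (set_valP u))).

Lemma fp_dom_subproof (k : fibre_product) :
  f1 (val (dom (val k).1)) = f2 (val (dom (val k).2)).
Proof. by rewrite -!hom_dom fpP. Qed.

Lemma fp_rng_subproof (k : fibre_product) :
  f1 (val (rng (val k).1)) = f2 (val (rng (val k).2)).
Proof. by rewrite -!hom_rng fpP. Qed.

Definition fp_dom k : fp_unit_space := fp_unit (fp_dom_subproof k).

Definition fp_rng k : fp_unit_space := fp_unit (fp_rng_subproof k).

Lemma fp_composable1 k' k : fp_dom k' = fp_rng k ->
  dom (val k').1 = rng (val k).1.
Proof. by move=> /(congr1 fp_unit1)/(congr1 val) /= e; exact: val_inj. Qed.

Lemma fp_composable2 k' k : fp_dom k' = fp_rng k ->
  dom (val k').2 = rng (val k).2.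
Proof. by move=> /(congr1 fp_unit2)/(congr1 val) /= e; exact: val_inj. Qed.

Lemma fp_mul_subproof k' k (e : fp_dom k' = fp_rng k) :
  f1 (mul (fp_composable1 e)) = f2 (mul (fp_composable2 e)).
Proof.
rewrite (hom_mul _ (hom_composable f1 (fp_composable1 e))).
rewrite (hom_mul _ (hom_composable f2 (fp_composable2 e))).
by apply: mul_eq; exact: fpP.
Qed.

Definition fp_mul k' k (e : fp_dom k' = fp_rng k) : fibre_product :=
  fp_pair (fp_mul_subproof e).

Lemma fp_inv_subproof (k : fibre_product) :
  f1 (inv (val k).1) = f2 (inv (val k).2).
Proof. by rewrite !hom_inv fpP. Qed.

Definition fp_inv k : fibre_product := fp_pair (fp_inv_subproof k).

Definition fp_groupoid : groupoid.
Proof.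
refine (@Groupoid fibre_product fp_unit_space fp_dom fp_rng fp_mul fp_inv
  _ _ _ _ _ _ _ _ _ _ _).
- move=> u; have [/mem_set u1 /mem_set u2] := set_valP u.
  by apply: fp_unit_eq; rewrite /= ?(dom_unit (SigSub u1))
    ?(dom_unit (SigSub u2)).
- move=> u; have [/mem_set u1 /mem_set u2] := set_valP u.
  by apply: fp_unit_eq; rewrite /= ?(rng_unit (SigSub u1))
    ?(rng_unit (SigSub u2)).
- by move=> k' k e; apply: fp_unit_eq; rewrite /= dom_mul.
- by move=> k' k e; apply: fp_unit_eq; rewrite /= rng_mul.
- by move=> k e; apply: fp_eq; rewrite /= mul_unitr.
- by move=> k e; apply: fp_eq; rewrite /= mul_unitl.
- move=> k3 k2 k1 e32 e21 el er; apply: fp_eq => /=; last first.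
    exact: (mulA (fp_composable2 el) (fp_composable2 er)).
  exact: (mulA (fp_composable1 el) (fp_composable1 er)).
- by move=> k; apply: fp_unit_eq; rewrite /= dom_inv.
- by move=> k; apply: fp_unit_eq; rewrite /= rng_inv.
- by move=> k e; apply: fp_eq; rewrite /= mul_invl.
- by move=> k e; apply: fp_eq; rewrite /= mul_invr.
Defined.

Definition fp_proj1 : groupoid_hom fp_groupoid K1.
Proof.
refine (@GroupoidHom fp_groupoid K1 (fun k : fibre_product => (val k).1) _ _ _).
- by [].
- by [].
- by move=> k' k e e' /=; exact: mul_eq.
Defined.

Definition fp_proj2 : groupoid_hom fp_groupoid K2.
Proof.
refine (@GroupoidHom fp_groupoid K2 (fun k : fibre_product => (val k).2) _ _ _).
- by [].
- by [].
- by move=> k' k e e' /=; exact: mul_eq.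
Defined.

Lemma fp_proj1_continuous : continuous fp_proj1.
Proof. exact: continuous_cmp (@continuous_set_val _ _) (@continuous_fst _ _). Qed.

Lemma fp_proj2_continuous : continuous fp_proj2.
Proof. exact: continuous_cmp (@continuous_set_val _ _) (@continuous_snd _ _). Qed.

Lemma continuous_to_fp (X : topologicalType) (h : X -> fp_groupoid) :
  continuous (fun x => fp_proj1 (h x)) -> continuous (fun x => fp_proj2 (h x)) ->
  continuous h.
Proof.
move=> c1 c2; apply: continuous_to_set_type.
rewrite (_ : (fun x => _) = fun x => (fp_proj1 (h x), fp_proj2 (h x))).
  exact: continuous_pair.
by apply/funext => x /=; rewrite -surjective_pairing.
Qed.

End FibreProduct.

Section FibreProductEtale.
Variables (K1 K2 G : etale_groupoid).
Variables (f1 : groupoid_hom K1 G) (f2 : groupoid_hom K2 G).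
Hypotheses (cf1 : continuous f1) (cf2 : continuous f2).

Let P := fp_groupoid f1 f2.

Lemma fp_topological : is_topological_groupoid P.
Proof.
have cp1 : continuous (fun p : composable P => (val p).1).
  exact: continuous_cmp (@continuous_set_val _ _) (@continuous_fst _ _).
have cp2 : continuous (fun p : composable P => (val p).2).
  exact: continuous_cmp (@continuous_set_val _ _) (@continuous_snd _ _).
split.
  apply: continuous_to_fp.
    apply: (@continuous_mul_pair _ _ (fun p : composable P => fp_proj1 f1 f2 (val p).1)
      (fun p => fp_proj1 f1 f2 (val p).2)
      (fun p => fp_composable1 (set_valP p)) (etaleP K1)).
      exact: continuous_cmp cp1 (@fp_proj1_continuous _ _ _ _ _).
    exact: continuous_cmp cp2 (@fp_proj1_continuous _ _ _ _ _).
  apply: (@continuous_mul_pair _ _ (fun p : composable P => fp_proj2 f1 f2 (val p).1)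
    (fun p => fp_proj2 f1 f2 (val p).2)
    (fun p => fp_composable2 (set_valP p)) (etaleP K2)).
    exact: continuous_cmp cp1 (@fp_proj2_continuous _ _ _ _ _).
  exact: continuous_cmp cp2 (@fp_proj2_continuous _ _ _ _ _).
apply: continuous_to_fp.
  exact: continuous_cmp (@fp_proj1_continuous _ _ _ _ _)
    (continuous_inv (etaleP K1)).
exact: continuous_cmp (@fp_proj2_continuous _ _ _ _ _)
  (continuous_inv (etaleP K2)).
Qed.

Lemma nbhs_fp (k : P) (V : set P) : nbhs k V -> exists U1 U2,
  [/\ nbhs (fp_proj1 f1 f2 k) U1, nbhs (fp_proj2 f1 f2 k) U2 &
      forall l : P, U1 (fp_proj1 f1 f2 l) -> U2 (fp_proj2 f1 f2 l) -> V l].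
Proof.
move=> /nbhs_set_type[W [oW Wk WV]].
have : nbhs (val k) W by exact: open_nbhs_nbhs.
move=> [[U1 U2] /= [n1 n2] U12]; exists U1, U2; split => // l l1 l2.
by apply/WV/U12; split.
Qed.

Lemma nbhs_fp_unit (u : unit_space P) (V : set (unit_space P)) :
  nbhs u V <-> exists U1 U2,
  [/\ nbhs (hom0 (fp_proj1 f1 f2) u) U1, nbhs (hom0 (fp_proj2 f1 f2) u) U2 &
      forall v : unit_space P, U1 (hom0 (fp_proj1 f1 f2) v) ->
        U2 (hom0 (fp_proj2 f1 f2) v) -> V v].
Proof.
split=> [/nbhs_set_type[W [oW Wu WV]]|[U1 [U2 [n1 n2 UV]]]].
  have : nbhs (val u) W by exact: open_nbhs_nbhs.
  move=> /nbhs_fp[U1 [U2 [n1 n2 U12]]].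
  exists (val @^-1` U1), (val @^-1` U2); split.
  - exact: (@continuous_set_val _ _ (hom0 (fp_proj1 f1 f2) u)).
  - exact: (@continuous_set_val _ _ (hom0 (fp_proj2 f1 f2) u)).
  - by move=> v v1 v2; apply/WV/U12.
have c1 := continuous_hom0 (@fp_proj1_continuous _ _ _ f1 f2).
have c2 := continuous_hom0 (@fp_proj2_continuous _ _ _ f1 f2).
move: (c1 u _ n1) (c2 u _ n2); rewrite !nbhs_simpl/=.
by apply: filterS2 => v; exact: UV.
Qed.

Lemma fp_etale : is_etale P.
Proof.
have /local_homeomorphismP[cd1 od1 id1] := etale_dom (etaleP K1).
have /local_homeomorphismP[cd2 od2 id2] := etale_dom (etaleP K2).
have /local_homeomorphismP[cd od id] := etale_dom (etaleP G).
split; first exact: fp_topological.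
apply/local_homeomorphismP; split.
- apply: continuous_to_set_type; apply: continuous_to_fp.
    apply: continuous_cmp (@continuous_set_val _ _).
    exact: continuous_cmp (@fp_proj1_continuous _ _ _ _ _) cd1.
  apply: continuous_cmp (@continuous_set_val _ _).
  exact: continuous_cmp (@fp_proj2_continuous _ _ _ _ _) cd2.
- apply/open_mapP => k V /nbhs_fp[U1 [U2 [n1 n2 UV]]].
  have [W [oW Wk Winj]] := id (f1 (val k).1).
  have nW : nbhs (f1 (val k).1) W by exact: open_nbhs_nbhs.
  apply/nbhs_fp_unit.
  exists (dom @` (U1 `&` f1 @^-1` W)), (dom @` (U2 `&` f2 @^-1` W)); split.
  + rewrite (_ : hom0 _ _ = dom (val k).1); last exact: val_inj.
    move/open_mapP: od1; apply; apply: filterI => //; exact: cf1 nW.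
  + rewrite (_ : hom0 _ _ = dom (val k).2); last exact: val_inj.
    move/open_mapP: od2; apply; apply: filterI => //.
    by move: nW; rewrite (fpP k) => nW; exact: cf2 nW.
  + move=> v [k1 [Uk1 Wk1] dk1] [k2 [Uk2 Wk2] dk2].
    have e : f1 k1 = f2 k2.
      apply: Winj; rewrite ?inE//; rewrite !dom_hom dk1 dk2.
      by apply: val_inj => /=; exact: (fpP (val v)).
    exists (fp_pair e); first exact: UV.
    by apply: fp_unit_eq => /=; rewrite ?dk1 ?dk2.
- move=> k.
  have [U1 [oU1 U1k U1inj]] := id1 (val k).1.
  have [U2 [oU2 U2k U2inj]] := id2 (val k).2.
  exists ((fp_proj1 f1 f2 @^-1` U1) `&` (fp_proj2 f1 f2 @^-1` U2)); split => //.
    apply: openI; apply: open_comp => // l _.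
      exact: fp_proj1_continuous.
    exact: fp_proj2_continuous.
  move=> l m /set_mem[l1 l2] /set_mem[m1 m2] lm; apply: fp_eq.
    by apply: U1inj; rewrite ?inE//; exact: val_inj (congr1 (fun u => (val (val u)).1) lm).
  by apply: U2inj; rewrite ?inE//; exact: val_inj (congr1 (fun u => (val (val u)).2) lm).
Qed.

Definition fp_etale_groupoid : etale_groupoid := EtaleGroupoid fp_etale.

End FibreProductEtale.

Section Pairing.
Variables (K1 K2 G X : groupoid).
Variables (f1 : groupoid_hom K1 G) (f2 : groupoid_hom K2 G).
Variables (h1 : groupoid_hom X K1) (h2 : groupoid_hom X K2).
Hypothesis h12 : forall x, f1 (h1 x) = f2 (h2 x).

Definition fp_pairing : groupoid_hom X (fp_groupoid f1 f2).
Proof.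
refine (@GroupoidHom X (fp_groupoid f1 f2) (fun x => fp_pair (h12 x)) _ _ _).
- by move=> x; apply: fp_eq; rewrite /= hom_dom.
- by move=> x; apply: fp_eq; rewrite /= hom_rng.
- by move=> x' x e e'; apply: fp_eq; exact: hom_mul.
Defined.

Lemma fp_pairing_continuous :
  continuous h1 -> continuous h2 -> continuous fp_pairing.
Proof. by move=> c1 c2; exact: continuous_to_fp. Qed.

End Pairing.

Definition id_couple (G : etale_groupoid) : couple G G.
Proof.
refine (@Couple G G G (id_hom G) (id_hom G) _ _ _ _ _).
- by move=> x; exact: cvg_id.
- move=> u; have -> : hom0 (id_hom G) u = u by exact: val_inj.
  by split=> // g gu; exists g.
- by move=> x; exact: cvg_id.
- move=> U oU; rewrite (_ : hom0 (id_hom G) = id) ?image_id//.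
  by apply/funext => u; exact: val_inj.
- by move=> u v /(congr1 val) /= uv; exact: val_inj.
Defined.

Section Composition.
Variables (G1 G2 G3 : etale_groupoid) (c1 : couple G1 G2) (c2 : couple G2 G3).

Let K := fp_etale_groupoid (@right_continuous _ _ c1) (@left_continuous _ _ c2).
Let p1 : groupoid_hom K (mid c1) := fp_proj1 (right c1) (left c2).
Let p2 : groupoid_hom K (mid c2) := fp_proj2 (right c1) (left c2).

Lemma comp_left_continuous : continuous (comp_hom p1 (left c1)).
Proof.
exact: continuous_cmp (@fp_proj1_continuous _ _ _ _ _)
  (@left_continuous _ _ c1).
Qed.

Lemma comp_right_continuous : continuous (comp_hom p2 (right c2)).
Proof.
exact: continuous_cmp (@fp_proj2_continuous _ _ _ _ _)
  (@right_continuous _ _ c2).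
Qed.

Lemma comp_left_bijective : fibrewise_bijective (comp_hom p1 (left c1)).
Proof.
rewrite /fibrewise_bijective /source_fibre => u.
have [f1 i1 s1] := @left_bijective _ _ c1 (hom0 p1 u).
have [f2 i2 s2] := @left_bijective _ _ c2 (hom0 p2 u).
split.
- by move=> k <-; exact: (dom_hom (comp_hom p1 (left c1)) k).
- move=> k l /set_mem ku /set_mem lu /= kl.
  have k1 : dom (val k).1 = hom0 p1 u.
    by rewrite -ku; exact: (dom_hom p1 k).
  have l1 : dom (val l).1 = hom0 p1 u.
    by rewrite -lu; exact: (dom_hom p1 l).
  have k2 : dom (val k).2 = hom0 p2 u.
    by rewrite -ku; exact: (dom_hom p2 k).
  have l2 : dom (val l).2 = hom0 p2 u.
    by rewrite -lu; exact: (dom_hom p2 l).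
  have kl1 : (val k).1 = (val l).1 by apply: i1; rewrite ?inE.
  apply: fp_eq => //; apply: i2; rewrite ?inE//.
  by rewrite -(fpP k) -(fpP l) kl1.
- move=> g gu.
  have [|k1 k1u k1g] := s1 g; first by rewrite /source_fibre /= gu; exact: val_inj.
  have [|k2 k2u k12] := s2 (right c1 k1).
    rewrite /source_fibre /= dom_hom k1u; apply: val_inj => /=.
    exact: (fpP (val u)).
  exists (fp_pair (esym k12)) => //.
  by apply: fp_unit_eq => /=; rewrite ?k1u ?k2u.
Qed.

Lemma comp_right_inj : injective (hom0 (comp_hom p2 (right c2))).
Proof.
move=> u v /(congr1 val) /= uv.
have e2 : hom0 p2 u = hom0 p2 v.
  by apply: (@right_inj _ _ c2); exact: val_inj.
have e1 : hom0 p1 u = hom0 p1 v.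
  apply: (@right_inj _ _ c1); apply: val_inj => /=.
  rewrite (fpP (val u)) (fpP (val v)).
  by rewrite -[(val (val u)).2]/(val (hom0 p2 u)) e2.
by apply: fp_unit_eq; [exact: (congr1 val e1)|exact: (congr1 val e2)].
Qed.

Lemma comp_right_open : open_map (hom0 (comp_hom p2 (right c2))).
Proof.
apply/open_mapP => u V /nbhs_fp_unit[U1 [U2 [n1 n2 UV]]].
have /open_mapP o1 := @right_open _ _ c1.
have /open_mapP o2 := @right_open _ _ c2.
have nW : nbhs (hom0 (left c2) (hom0 p2 u)) (hom0 (right c1) @` U1).
  rewrite (_ : hom0 _ _ = hom0 (right c1) (hom0 p1 u)); first exact: o1.
  by apply: val_inj => /=; exact/esym/(fpP (val u)).
have c := continuous_hom0 (@left_continuous _ _ c2).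
have n : nbhs (hom0 p2 u) (U2 `&` (hom0 (left c2) @^-1` (hom0 (right c1) @` U1))).
  by apply: filterI => //; exact: c nW.
rewrite (_ : hom0 _ _ = hom0 (right c2) (hom0 p2 u)); last exact: val_inj.
apply: filterS (o2 _ _ n) => _ [k2 [Uk2 [k1 Uk1 k12]] <-].
exists (fp_unit (congr1 val k12)); last exact: val_inj.
apply: UV.
  by rewrite (_ : hom0 _ _ = k1)//; exact: val_inj.
by rewrite (_ : hom0 _ _ = k2)//; exact: val_inj.
Qed.

Definition comp_couple : couple G1 G3 :=
  @Couple G1 G3 K (comp_hom p1 (left c1)) (comp_hom p2 (right c2))
    comp_left_continuous comp_left_bijective
    comp_right_continuous comp_right_open comp_right_inj.

End Composition.

Lemma couple_equiv_refl (G H : etale_groupoid) (c : couple G H) :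
  couple_equiv c c.
Proof.
by exists (id_hom _), (id_hom _); split => //; split => // x; exact: cvg_id.
Qed.

Lemma couple_equiv_sym (G H : etale_groupoid) (c d : couple G H) :
  couple_equiv c d -> couple_equiv d c.
Proof.
move=> [i [j [[ij ji] [ci cj] l r]]]; exists j, i; split => //.
  by rewrite -l; apply/funext => x /=; rewrite ji.
by rewrite -r; apply/funext => x /=; rewrite ji.
Qed.

Lemma couple_equiv_trans (G H : etale_groupoid) (c d e : couple G H) :
  couple_equiv c d -> couple_equiv d e -> couple_equiv c e.
Proof.
move=> [i [j [[ij ji] [ci cj] l r]]] [i' [j' [[ij' ji'] [ci' cj'] l' r']]].
exists (comp_hom i i'), (comp_hom j' j); split.
- by split=> x /=; rewrite ?ij' ?ij ?ji ?ji'.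
- by split; [exact: continuous_cmp ci ci'|exact: continuous_cmp cj' cj].
- by rewrite -l -l'.
- by rewrite -r -r'.
Qed.

Lemma comp_couple_equiv (G1 G2 G3 : etale_groupoid) (c1 d1 : couple G1 G2)
    (c2 d2 : couple G2 G3) : couple_equiv c1 d1 -> couple_equiv c2 d2 ->
  couple_equiv (comp_couple c1 c2) (comp_couple d1 d2).
Proof.
have half (a1 b1 : couple G1 G2) (a2 b2 : couple G2 G3)
    (i1 : groupoid_hom (mid a1) (mid b1))
    (i2 : groupoid_hom (mid a2) (mid b2)) :
    right b1 \o i1 = right a1 -> left b2 \o i2 = left a2 ->
    forall k : mid (comp_couple a1 a2),
      right b1 (comp_hom (fp_proj1 (right a1) (left a2)) i1 k) =
      left b2 (comp_hom (fp_proj2 (right a1) (left a2)) i2 k).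
  move=> r1 l2 k.
  have /= -> := congr1 (@^~ (val k).1) r1.
  have /= -> := congr1 (@^~ (val k).2) l2.
  exact: fpP.
move=> [i1 [j1 [[ij1 ji1] [ci1 cj1] l1 r1]]].
move=> [i2 [j2 [[ij2 ji2] [ci2 cj2] l2 r2]]].
have r1' : right c1 \o j1 = right d1.
  by rewrite -r1; apply/funext => x /=; rewrite ji1.
have l2' : left c2 \o j2 = left d2.
  by rewrite -l2; apply/funext => x /=; rewrite ji2.
exists (fp_pairing (half _ _ _ _ _ _ r1 l2)).
exists (fp_pairing (half _ _ _ _ _ _ r1' l2')).
have cp1 := @fp_proj1_continuous; have cp2 := @fp_proj2_continuous.
split.
- by split=> k; apply: fp_eq => /=; rewrite ?ij1 ?ij2 ?ji1 ?ji2.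
- split; apply: fp_pairing_continuous.
  + exact: continuous_cmp (cp1 _ _ _ _ _) ci1.
  + exact: continuous_cmp (cp2 _ _ _ _ _) ci2.
  + exact: continuous_cmp (cp1 _ _ _ _ _) cj1.
  + exact: continuous_cmp (cp2 _ _ _ _ _) cj2.
- by apply/funext => k /=; rewrite -l1.
- by apply/funext => k /=; rewrite -r2.
Qed.

Lemma comp_couple_idl (G H : etale_groupoid) (c : couple G H) :
  couple_equiv (comp_couple (id_couple G) c) c.
Proof.
exists (fp_proj2 (id_hom G) (left c)).
exists (@fp_pairing _ _ _ _ (id_hom G) (left c) (left c) (id_hom (mid c))
  (fun=> erefl)).
split.
- split=> k //; apply: fp_eq => //=; exact/esym/(fpP k).
- split; first exact: fp_proj2_continuous.
  apply: fp_pairing_continuous; first exact: left_continuous.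
  by move=> x; exact: cvg_id.
- by apply/funext => k /=; rewrite -(fpP k).
- by [].
Qed.

Lemma comp_couple_idr (G H : etale_groupoid) (c : couple G H) :
  couple_equiv (comp_couple c (id_couple H)) c.
Proof.
exists (fp_proj1 (right c) (id_hom H)).
exists (@fp_pairing _ _ _ _ (right c) (id_hom H) (id_hom (mid c)) (right c)
  (fun=> erefl)).
split.
- split=> k //; apply: fp_eq => //=; exact: (fpP k).
- split; first exact: fp_proj1_continuous.
  apply: fp_pairing_continuous; last exact: right_continuous.
  by move=> x; exact: cvg_id.
- by [].
- by apply/funext => k /=; rewrite (fpP k).
Qed.

Lemma comp_coupleA (G1 G2 G3 G4 : etale_groupoid) (c1 : couple G1 G2)
    (c2 : couple G2 G3) (c3 : couple G3 G4) :
  couple_equiv (comp_couple c1 (comp_couple c2 c3))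
               (comp_couple (comp_couple c1 c2) c3).
Proof.
pose c23 := comp_couple c2 c3; pose c12 := comp_couple c1 c2.
pose a1 := fp_proj1 (right c1) (left c23).
pose a23 := fp_proj2 (right c1) (left c23).
pose a2 := comp_hom a23 (fp_proj1 (right c2) (left c3)).
pose a3 := comp_hom a23 (fp_proj2 (right c2) (left c3)).
pose b12 := fp_proj1 (right c12) (left c3).
pose b1 := comp_hom b12 (fp_proj1 (right c1) (left c2)).
pose b2 := comp_hom b12 (fp_proj2 (right c1) (left c2)).
pose b3 := fp_proj2 (right c12) (left c3).
have a12P k : right c1 (a1 k) = left c2 (a2 k) by exact: (fpP k).
pose a12 := fp_pairing a12P.
have aP k : right c12 (a12 k) = left c3 (a3 k) by exact: (fpP (val k).2).
have b23P k : right c2 (b2 k) = left c3 (b3 k) by exact: (fpP k).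
pose b23 := fp_pairing b23P.
have bP k : right c1 (b1 k) = left c23 (b23 k) by exact: (fpP (val k).1).
have cp1 := @fp_proj1_continuous; have cp2 := @fp_proj2_continuous.
exists (fp_pairing aP), (fp_pairing bP); split => //.
- by split=> k; apply: fp_eq => //; exact: fp_eq.
- split; apply: fp_pairing_continuous.
  + apply: fp_pairing_continuous; first exact: cp1.
    exact: continuous_cmp (cp2 _ _ _ _ _) (cp1 _ _ _ _ _).
  + exact: continuous_cmp (cp2 _ _ _ _ _) (cp2 _ _ _ _ _).
  + exact: continuous_cmp (cp1 _ _ _ _ _) (cp1 _ _ _ _ _).
  + apply: fp_pairing_continuous; last exact: cp2.
    exact: continuous_cmp (cp1 _ _ _ _ _) (cp2 _ _ _ _ _).
Qed.

(* Morphisms of EG are equivalence classes, as predicates: couples range over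
   large types, to which the library quotients do not apply. *)
Record couple_class (G H : etale_groupoid) := CoupleClass {
  class_pred :> couple G H -> Prop;
  couple_classP : exists c, class_pred = couple_equiv c }.

Definition class_of (G H : etale_groupoid) (c : couple G H) : couple_class G H :=
  @CoupleClass G H (couple_equiv c) (ex_intro _ c erefl).

Lemma class_eq (G H : etale_groupoid) (C D : couple_class G H) :
  (forall c, C c <-> D c) -> C = D.
Proof.
case: C D => [C pC] [D pD] /= CD.
have E : C = D by apply/funext => c; exact/propext.
by subst D; congr CoupleClass; exact: Prop_irrelevance.
Qed.

Lemma class_of_eq (G H : etale_groupoid) (c d : couple G H) :
  couple_equiv c d -> class_of c = class_of d.
Proof.
move=> cd; apply: class_eq => e /=; split; apply: couple_equiv_trans => //.
exact: couple_equiv_sym.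
Qed.

Lemma class_ofP (G H : etale_groupoid) (C : couple_class G H) :
  exists c, C = class_of c.
Proof.
by have [c Cc] := couple_classP C; exists c; apply: class_eq => d; rewrite Cc.
Qed.

Lemma comp_class_subproof (G1 G2 G3 : etale_groupoid) (C : couple_class G1 G2)
    (D : couple_class G2 G3) :
  exists c0, (fun c => exists c1 c2,
    [/\ C c1, D c2 & couple_equiv (comp_couple c1 c2) c]) = couple_equiv c0.
Proof.
have [c1 ->] := class_ofP C; have [c2 ->] := class_ofP D.
exists (comp_couple c1 c2); apply/funext => c; apply/propext; split.
  move=> [d1 [d2 [/= e1 e2]]]; apply: couple_equiv_trans.
  exact: comp_couple_equiv.
by move=> e; exists c1, c2; split=> //; exact: couple_equiv_refl.
Qed.

(* The product of classes is again a class by [comp_class_subproof]; on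
   representatives it is computed by [comp_classE]. *)
Definition comp_class (G1 G2 G3 : etale_groupoid) (C : couple_class G1 G2)
  (D : couple_class G2 G3) : couple_class G1 G3 :=
  CoupleClass (comp_class_subproof C D).

Lemma comp_classE (G1 G2 G3 : etale_groupoid) (c1 : couple G1 G2)
    (c2 : couple G2 G3) :
  comp_class (class_of c1) (class_of c2) = class_of (comp_couple c1 c2).
Proof.
apply: class_eq => c /=; split.
  move=> [d1 [d2 [/= e1 e2]]]; apply: couple_equiv_trans.
  exact: comp_couple_equiv.
by move=> e; exists c1, c2; split=> //; exact: couple_equiv_refl.
Qed.

(* [comp f g] is "first f, then g". *)
Record category := Category {
  object : Type;
  morphism : object -> object -> Type;
  identity : forall a, morphism a a;
  comp : forall a b c, morphism a b -> morphism b c -> morphism a c;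
  comp_idl : forall a b (f : morphism a b), comp (identity a) f = f;
  comp_idr : forall a b (f : morphism a b), comp f (identity b) = f;
  compA : forall a b c d
    (f : morphism a b) (g : morphism b c) (h : morphism c d),
    comp f (comp g h) = comp (comp f g) h }.

Definition EG : category.
Proof.
refine (@Category etale_groupoid couple_class
  (fun G => class_of (id_couple G)) comp_class _ _ _).
- move=> G H C; have [c ->] := class_ofP C.
  by rewrite comp_classE; apply: class_of_eq; exact: comp_couple_idl.
- move=> G H C; have [c ->] := class_ofP C.
  by rewrite comp_classE; apply: class_of_eq; exact: comp_couple_idr.
- move=> G1 G2 G3 G4 C1 C2 C3.
  have [c1 ->] := class_ofP C1; have [c2 ->] := class_ofP C2.
  have [c3 ->] := class_ofP C3.
  by rewrite !comp_classE; apply: class_of_eq; exact: comp_coupleA.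
Defined.

Record is_subcategory (C : category) (O : object C -> Prop)
    (M : forall a b : object C, morphism a b -> Prop) : Prop := {
  sub_source : forall a b (f : morphism a b), M a b f -> O a;
  sub_target : forall a b (f : morphism a b), M a b f -> O b;
  sub_identity : forall a, O a -> M a a (identity a);
  sub_comp : forall a b c (f : morphism a b) (g : morphism b c),
    M a b f -> M b c g -> M a c (comp f g) }.

Definition proper_couple (G H : etale_groupoid) (c : couple G H) : Prop :=
  proper_map (hom0 (left c)).

Lemma proper_couple_equiv (G H : etale_groupoid) (c d : couple G H) :
  couple_equiv c d -> proper_couple c -> proper_couple d.
Proof.
move=> [i [j [[ij ji] [ci cj] l r]]] pc C /pc cC.
have -> : hom0 (left d) @^-1` C = hom0 i @` (hom0 (left c) @^-1` C).
  apply/seteqP; split=> [u Cu|_ [u Cu <-]].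
    exists (hom0 j u); last by apply: val_inj => /=; rewrite ji.
    rewrite /= (_ : hom0 _ _ = hom0 (left d) u)//.
    by apply: val_inj; rewrite /= -l /= ji.
  rewrite /= (_ : hom0 _ _ = hom0 (left c) u)//.
  by apply: val_inj; rewrite /= -l.
apply: continuous_compact => //.
by apply: continuous_subspaceT; exact: continuous_hom0.
Qed.

(* By [proper_couple_equiv], one proper representative makes all of them
   proper. *)
Definition proper_class (G H : etale_groupoid) (C : couple_class G H) : Prop :=
  exists2 c, C c & proper_couple c.

Lemma proper_classE (G H : etale_groupoid) (c : couple G H) :
  proper_class (class_of c) <-> proper_couple c.
Proof.
split=> [[d cd]|pc]; last by exists c => //; exact: couple_equiv_refl.
exact: proper_couple_equiv (couple_equiv_sym cd).
Qed.

Definition lch_unit_space (G : etale_groupoid) : Prop :=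
  hausdorff_space (unit_space G) /\ locally_compact [set: unit_space G].

Definition proper_lch_class (G H : etale_groupoid) (C : couple_class G H) :=
  [/\ lch_unit_space G, lch_unit_space H & proper_class C].

(* Main.v *)
Require Import Defs.
From mathcomp Require Import all_boot all_classical topology.

(** Only stability of properness under composition has content.  Write a
composite of couples as (left, right; K) with K the fibre product of the middle
groupoids K1 and K2 of [c1] and [c2].  A unit of K is a pair (u1, u2) of units
with psi1 u1 = phi2 u2.  Since psi1 is injective on units, such a pair is
determined by u2, hence also by its image psi2 u2 under [right], as psi2 is
injective on units too.  So for a set C of units of the source, the preimage of
C under [left] can be carried along the two couples,

  C,  phi1^-1 C,  psi1 (phi1^-1 C),  phi2^-1 (psi1 (phi1^-1 C)),
  psi2 (phi2^-1 (psi1 (phi1^-1 C))),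

and recovered as the preimage of the last set under [right]
([comp_left_preimage]).  If C is compact, properness of the phi's and continuity
of the psi's keep each of these sets compact.  On units, [right] is open and
injective, and its range contains the last set, so the preimage is compact as
well ([compact_preimage_open_inj]). *)

Set Implicit Arguments.
Unset Strict Implicit.
Unset Printing Implicit Defensive.

Local Open Scope classical_set_scope.

(** An open injective map has a continuous inverse on its range, and the preimage
of [B] is the image of [B] under it.  In terms of filters: a cluster point [f x]
of the image filter lifts to the cluster point [x], since [f] maps neighbourhoods
of [x] to neighbourhoods of [f x]. *)
Lemma compact_preimage_open_inj (X Y : topologicalType) (f : X -> Y)
    (B : set Y) :
  open_map f -> injective f -> B `<=` range f -> compact B ->
  compact (f @^-1` B).
Proof.
move=> /open_mapP fo finj Bf cB F FF FB.
have [y [By Fy]] := cB (f @ F) (fmap_proper_filter f FF) FB.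
have [x _ fx] := Bf y By; exists x; split; first by rewrite /= fx.
move=> U V FU xV.
have FfU : (f @ F) (f @` U) by apply: (@filterS _ F _ U) => // u Uu; exists u.
have yfV : nbhs y (f @` V) by rewrite -fx; exact: fo.
have [_ [[u Uu <-] [v Vv vu]]] := Fy _ _ FfU yfV.
by exists u; split=> //; rewrite -(finj _ _ vu).
Qed.

Lemma proper_id_couple (G : etale_groupoid) : proper_couple (id_couple G).
Proof.
move=> C cC; rewrite (_ : hom0 _ = id)//.
by apply/funext => u; exact: val_inj.
Qed.

Section Composition.
Variables (G1 G2 G3 : etale_groupoid) (c1 : couple G1 G2) (c2 : couple G2 G3).
Let c := comp_couple c1 c2.

(** The image, under the second projection, of the units of the fibre product
lying over [C]; written as successive images and preimages so that compactness
passes from [C] to it one couple at a time. *)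
Let B (C : set (unit_space G1)) : set (unit_space (mid c2)) :=
  hom0 (left c2) @^-1` (hom0 (right c1) @` (hom0 (left c1) @^-1` C)).

(** A unit in [B C] has, by definition of [B], a partner in the first middle
groupoid: the pair is a unit of the fibre product over [C]. *)
Lemma comp_unit_lift (C : set (unit_space G1)) (u2 : unit_space (mid c2)) :
  B C u2 -> exists u : unit_space (mid c),
    C (hom0 (left c) u) /\ hom0 (right c) u = hom0 (right c2) u2.
Proof.
move=> [u1 Cu1 u12]; exists (fp_unit (congr1 val u12)); split.
  by rewrite (_ : hom0 _ _ = hom0 (left c1) u1)//; exact: val_inj.
exact: val_inj.
Qed.

Lemma comp_left_preimage (C : set (unit_space G1)) :
  hom0 (left c) @^-1` C =
  hom0 (right c) @^-1` (hom0 (right c2) @` B C).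
Proof.
apply/seteqP; split=> [u Cu|u /= [u2 /comp_unit_lift[v [Cv vu2]] u2u]].
  exists (fp_unit2 u); last exact: val_inj.
  exists (fp_unit1 u); last by apply: val_inj; exact: (fpP (val u)).
  by rewrite /= (_ : hom0 _ _ = hom0 (left c) u)//; exact: val_inj.
by rewrite -(right_inj (etrans vu2 u2u)).
Qed.

Lemma proper_comp_couple :
  proper_couple c1 -> proper_couple c2 -> proper_couple c.
Proof.
move=> p1 p2 C cC; rewrite comp_left_preimage.
apply: compact_preimage_open_inj.
- exact: right_open.
- exact: right_inj.
- by move=> _ [u2 /comp_unit_lift[u [_ uu2]] <-]; exists u.
have compact_right (H H' : etale_groupoid) (d : couple H H') D :
    compact D -> compact (hom0 (right d) @` D).
  apply: continuous_compact; apply: continuous_subspaceT.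
  exact: continuous_hom0 (@right_continuous _ _ d).
by apply/compact_right/p2/compact_right/p1.
Qed.

End Composition.

Theorem theorem4p39 : @is_subcategory EG lch_unit_space proper_lch_class.
Proof.
split=> [G H C []//|G H C []//|G lG|G1 G2 G3 C1 C2 [l1 _ pC1] [_ l3 pC2]].
  by split=> //; apply/proper_classE; exact: proper_id_couple.
split=> //; move: pC1 pC2.
have [c1 ->] := class_ofP C1; have [c2 ->] := class_ofP C2.
move=> /proper_classE p1 /proper_classE p2; rewrite /= comp_classE.
by apply/proper_classE; exact: proper_comp_couple.
Qed.
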